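(* The Grassmannian $\mathrm{Gr}_0(3,9)$ has an initial degeneration with two connected components; that is, there is a weight vector $w$ such that $\mathrm{in}_w\mathrm{Gr}_0(3,9)$ has two connected components.
   Context: Let $\mathbf{k}$ be an algebraically closed field of characteristic $0$. $\mathrm{Gr}(d,n)\subset\mathbb{P}(\wedge^d\mathbf{k}^n)$ is the Grassmannian of $d$-dimensional subspaces of $\mathbf{k}^n$ in its Plücker embedding, with homogeneous coordinates $p_\lambda$ indexed by $d$-element subsets $\lambda$ of $[n]=\{0,\dots,n-1\}$ and Plücker ideal $I^{d,n}\subset\mathbf{k}[p_\lambda]$. $\mathrm{Gr}_0(d,n)=\mathrm{Gr}(d,n)\cap T$, where $T$ is the dense torus of $\mathbb{P}(\wedge^d\mathbf{k}^n)$ (all $p_\lambda\ne0$). For a real weight vector $w$ with coordinates indexed by the $d$-subsets of $[n]$, the initial form $\mathrm{in}_wf$ of a polynomial $f$ is the sum of its terms of minimal $w$-weight, $\mathrm{in}_wI=\langle\mathrm{in}_wf: f\in I\rangle$, and the initial degeneration is $\mathrm{in}_w\mathrm{Gr}_0(d,n)=T\cap\mathrm{Proj}(\mathbf{k}[p_\lambda]/\mathrm{in}_wI^{d,n})$. *)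

(* Defs.v *)
From HB Require Import structures.
From mathcomp Require Import all_boot all_order all_algebra.
From mathcomp Require Import mpoly.
From mathcomp Require Import boolp classical_sets cardinality reals topology.

Set Implicit Arguments.
Unset Strict Implicit.
Unset Printing Implicit Defensive.

Import Order.TTheory GRing.Theory Num.Theory.

Local Open Scope classical_set_scope.
Local Open Scope ring_scope.

(* The points of Proj k[X_0, ..., X_(N-1)]: homogeneous prime ideals that do not
   contain the irrelevant ideal. [idealr_closed] includes properness. Ideals are
   boolean predicates, as in ring_quotient; classically this is no restriction. *)
Record proj_space (k : fieldType) (N : nat) := ProjSpace {
  prime_of :> {pred {mpoly k[N]}};
  prime_of_ideal : idealr_closed prime_of;
  prime_of_prime : prime_idealr_closed prime_of;
  prime_of_homog : forall (e : nat) (f : {mpoly k[N]}),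
    f \in prime_of -> pihomog [measure of mdeg] e f \in prime_of;
  prime_of_relevant : exists i : 'I_N, 'X_i \notin prime_of
}.

Section ZariskiTopology.
Variables (k : fieldType) (N : nat).

Definition zeros (E : set {mpoly k[N]}) : set (proj_space k N) :=
  [set P | forall f, E f -> f \in prime_of P].

(* Since points are homogeneous ideals, an arbitrary set E has the same zeros as
   the homogeneous ideal generated by the homogeneous components of its members. *)
Definition zariski_open (U : set (proj_space k N)) : Prop :=
  exists E : set {mpoly k[N]}, U = ~` zeros E.

Lemma zariski_openT : zariski_open setT.
Proof.
exists [set 1]; apply/seteqP; split=> // P _ /(_ 1 erefl).
by have [_ /negP] := prime_of_ideal P.
Qed.

Lemma zariski_openI (U V : set (proj_space k N)) :
  zariski_open U -> zariski_open V -> zariski_open (U `&` V).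
Proof.
move=> [E ->] [F ->]; exists [set h | exists f g, [/\ E f, F g & h = f * g]].
rewrite -setCU; congr (~` _); apply/seteqP; split=> P.
  have [_ _ Pid] := prime_of_ideal P.
  have Pmul a u : u \in prime_of P -> a * u \in prime_of P.
    move=> Pu; rewrite -[a * u]addr0; apply: Pid => //.
    by have [] := prime_of_ideal P.
  case=> PE h [f [g [Ef Fg ->]]]; last exact/Pmul/PE.
  by rewrite mulrC; exact/Pmul/PE.
move=> PEF; apply: contrapT => /not_orP[/existsNP[f /not_implyP[Ef fP]]].
move=> /existsNP[g /not_implyP[Fg gP]].
have /PEF/prime_of_prime/orP[//|//] : [set h | exists f g,
  [/\ E f, F g & h = f * g]] (f * g) by exists f, g.
Qed.

Lemma zariski_open_bigU (I : Type) (U : I -> set (proj_space k N)) :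
  (forall i, zariski_open (U i)) -> zariski_open (\bigcup_i U i).
Proof.
move=> /choice[E UE]; exists (\bigcup_i E i).
apply/seteqP; split=> P.
  by case=> i _; rewrite UE => PE Pall; apply: PE => f Ef; apply: Pall; exists i.
move=> /existsNP[f /not_implyP[[i _ Ef] fP]]; exists i => //.
by rewrite UE => /(_ _ Ef).
Qed.

HB.instance Definition _ := gen_eqMixin (proj_space k N).
HB.instance Definition _ := gen_choiceMixin (proj_space k N).
HB.instance Definition _ := isOpenTopological.Build (proj_space k N)
  zariski_openT zariski_openI zariski_open_bigU.

Definition dense_torus : set (proj_space k N) :=
  [set P | forall i : 'I_N, 'X_i \notin prime_of P].

Definition ideal_span (S : set {mpoly k[N]}) : set {mpoly k[N]} :=
  [set g | exists s : seq ({mpoly k[N]} * {mpoly k[N]}),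
     (forall u, u \in s -> S u.2) /\ g = \sum_(u <- s) u.1 * u.2].

End ZariskiTopology.

Section InitialIdeal.
Variables (k : fieldType) (R : realType) (N : nat) (w : 'I_N -> R).

Definition mnm_weight (m : 'X_{1..N}) : R := \sum_(i < N) w i *+ m i.

Definition initial_form (f : {mpoly k[N]}) : {mpoly k[N]} :=
  \sum_(m <- msupp f | all (fun m' => mnm_weight m <= mnm_weight m') (msupp f))
     f@_m *: 'X_[m].

Definition initial_ideal (I : set {mpoly k[N]}) : set {mpoly k[N]} :=
  ideal_span [set initial_form f | f in I].

End InitialIdeal.

Definition dsubset (d n : nat) := {l : {set 'I_n} | #|l| == d}.

(* Plücker variables are numbered by the enumeration of [dsubset d n]: the
   variable p_l is 'X_(enum_rank l), and 'X_i is p_(enum_val i). *)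
Definition nplucker (d n : nat) : nat := #|{: dsubset d n}|.

Section Grassmannian.
Variables (k : fieldType) (d n : nat).

(* [enum_val] lists the elements of a set of ordinals in increasing order. *)
Definition dsubset_nth (l : dsubset d n) (j : 'I_d) : 'I_n :=
  enum_val (cast_ord (esym (eqP (valP l))) j).

Definition plucker_coord (A : 'M[k]_(d, n)) (l : dsubset d n) : k :=
  \det (colsub (dsubset_nth l) A).

(* The homogeneous ideal of Gr(d, n): the polynomials vanishing on its affine
   cone. A d-dimensional subspace is the row space of a full-rank A. *)
Definition plucker_ideal : set {mpoly k[nplucker d n]} :=
  [set f | forall (c : k) (A : 'M[k]_(d, n)), row_free A ->
     f.@[fun i => c * plucker_coord A (enum_val i)] = 0].

(* T ∩ Proj(k[p]/in_w I), as a subspace of P(∧^d k^n): the underlying space of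
   Proj(k[p]/J) is the closed subset [zeros J] of Proj k[p]. *)
Definition initial_degeneration (R : realType) (w : dsubset d n -> R) :
    set (proj_space k (nplucker d n)) :=
  @dense_torus k (nplucker d n)
  `&` zeros (initial_ideal (fun i => w (enum_val i)) plucker_ideal).

End Grassmannian.

Arguments initial_degeneration k {d n R} w.

Definition connected_components (X : topologicalType) (A : set X) : set (set X) :=
  [set connected_component A x | x in A].

(* Main.v *)
Require Import Defs.
From HB Require Import structures.
From mathcomp Require Import all_boot all_order all_algebra.
From mathcomp Require Import mpoly.
From mathcomp Require Import boolp classical_sets cardinality reals topology.
From mathcomp Require Import generic_quotient ring_quotient fraction.
From Stdlib Require Import Ring Field.

(** Let Q be the Möbius-Kantor configuration on the points 0, ..., 7, whose
    three-point lines are {i, i+1, i+3} modulo 8, together with a ninth point on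
    no line through two of the others.  Over a field of characteristic 0, Q has
    exactly two realizations up to projective equivalence, rescaling of the
    columns and the choice of the ninth point: they correspond to the two
    primitive cube roots of unity z.  Give a Plücker coordinate the weight 1 if
    its index is one of the eight lines and 0 otherwise.  The initial
    degeneration for this weight splits according to z.

    For each z there is a family of matrices over k[parameters][t], [config],
    that realizes Q at t = 0 and whose minor on each line is t times a function
    that does not vanish identically at t = 0.  Let C be the vector of the
    coefficients of t^weight in its minors, [lead] at t = 0.  The polynomials
    that vanish on the cone over the generic C form a homogeneous prime, a point
    [component_point] of projective space lying in the torus.

    This point lies in the initial degeneration ([component_point_degeneration]):
    an f in the Plücker ideal vanishes on the minors of the family, and the
    coefficient of the lowest power of t in this identity is the initial form of
    f at C.

    Conversely, let P be a point of the initial degeneration, K its residue field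
    and x the coordinate vector of P in K.  Since all weights are nonnegative, the
    vector x' obtained from x by replacing the coordinates of positive weight by 0
    satisfies all Plücker relations ([truncation_zero]).  Relations that express
    Cramer's rule ([cramer_relation]) then make x' proportional to the minors of
    a 3 x 9 matrix over K, which realizes Q because every x_l is nonzero.  Hence
    this matrix is in the normal form given by one of the two z, and the
    coordinates of x on the lines, which are arbitrary, are matched by the
    first-order parameters of the family: these enter through an invertible
    linear system, of determinant 2z + 1 up to sign ([slopes_onto]).  Therefore
    x is a specialization of the generic C for that z, so P lies in the closure of
    the corresponding [component_point] ([degeneration_covered]).

    So the initial degeneration is the union of two relatively closed subsets,
    each containing a dense point and hence connected.  They are disjoint because
    z is a ratio of monomials in the coordinates ([components_disjoint]). *)

Set Implicit Arguments.
Unset Strict Implicit.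
Unset Printing Implicit Defensive.

Import Order.TTheory GRing.Theory Num.Theory.

Local Open Scope classical_set_scope.
Local Open Scope ring_scope.

(** * Evaluation of multivariate polynomials *)

Section Evaluation.
Variables (k : comNzRingType) (n : nat).

Lemma eq_mmap (S : nzRingType) (f1 f2 : k -> S) (h1 h2 : 'I_n -> S)
    (p : {mpoly k[n]}) :
  f1 =1 f2 -> h1 =1 h2 -> mmap f1 h1 p = mmap f2 h2 p.
Proof.
by move=> eqf eqh; apply: eq_bigr => m _; rewrite eqf (mmap1_eq _ eqh).
Qed.

Lemma rmorph_mmap (S S' : comNzRingType) (g : {rmorphism S -> S'})
    (f : k -> S) (h : 'I_n -> S) (p : {mpoly k[n]}) :
  g (mmap f h p) = mmap (g \o f) (g \o h) p.
Proof.
rewrite /mmap rmorph_sum; apply: eq_bigr => m _.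
by rewrite rmorphM rmorph_prod; congr (_ * _); apply: eq_bigr => i _; rewrite rmorphXn.
Qed.

Lemma rmorph_mpolyE (S : comNzRingType) (g : {rmorphism {mpoly k[n]} -> S})
    (p : {mpoly k[n]}) :
  g p = mmap (g \o @mpolyC n k) (fun i => g 'X_i) p.
Proof.
rewrite {1}[p]mpolyE rmorph_sum; apply: eq_bigr => m _.
rewrite -mul_mpolyC rmorphM; congr (_ * _).
by rewrite mpolyXE_id rmorph_prod; apply: eq_bigr => i _; rewrite rmorphXn.
Qed.

Lemma mmapXU (S : comNzRingType) (f : {rmorphism k -> S}) (h : 'I_n -> S) (i : 'I_n) :
  mmap f h 'X_i = h i.
Proof. by rewrite mmapX mmap1U. Qed.

End Evaluation.

Section Infinite.
Variables (k : fieldType) (char0 : [pchar k] =i pred0).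

Lemma poly_nonroot (g : {poly k}) : g != 0 -> exists x, g.[x] != 0.
Proof.
move=> g0; apply: contrapT => /forallNP gr.
suff: (size [seq i%:R : k | i <- iota 0 (size g)] < size g)%N.
  by rewrite size_map size_iota ltnn.
apply: max_poly_roots => //.
  by apply/allP => x _; apply: contrapT => /negP/gr.
have natr_inj (i j : nat) : (i <= j)%N -> i%:R = j%:R :> k -> i = j.
  move=> ij /eqP; rewrite eq_sym -subr_eq0 -natrB // ((pcharf0P k).1 char0) // subn_eq0 => ji.
  by apply/eqP; rewrite eqn_leq ij.
rewrite map_inj_uniq ?iota_uniq // => i j ij.
by case/orP: (leq_total i j) => /natr_inj; [|move=> /(_ (esym ij))]; auto.
Qed.

(** Induction on the number of variables: the last variable is separated, the
    induction hypothesis keeps the leading coefficient nonzero, and a nonroot of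
    the resulting univariate polynomial gives the last value. *)
Lemma mpoly_nonroot n (p : {mpoly k[n]}) : p != 0 -> exists v, p.@[v] != 0.
Proof.
elim: n p => [|n IHn] p p0.
  exists (fun=> 0); apply: contra_neq p0 => p0.
  have p1 : p = (p@_0)%:MP.
    apply/mpolyP => m; rewrite mcoeffC (_ : m = 0%MM) ?eqxx ?mulr1 //.
    by apply/mnmP; case.
  by move: p0; rewrite p1 mevalC => ->.
pose phi := mmap (polyC \o @mpolyC n k)
  (fun i => if unlift ord_max i is Some j then ('X_j)%:P else 'X : {poly {mpoly k[n]}}).
pose psi := mmap (@mpolyC n.+1 k) (fun j : 'I_n => 'X_(lift ord_max j)).
have phiK : cancel phi (horner_eval 'X_ord_max \o map_poly psi).
  move=> q; rewrite (rmorph_mmap (horner_eval 'X_ord_max \o map_poly psi)) [RHS]mpolyE.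
  apply: eq_bigr => m _; rewrite -mul_mpolyC; congr (_ * _).
    by rewrite /= map_polyC /horner_eval hornerC /psi /= mmapC.
  rewrite [RHS]mpolyXE_id; apply: eq_bigr => i _ /=; congr (_ ^+ _).
  rewrite /horner_eval; case: unliftP => [j ->|->] /=; last by rewrite map_polyX hornerX.
  by rewrite map_polyC hornerC /psi /= mmapXU.
have q0 : phi p != 0.
  by apply: contra_neq p0 => p0; rewrite -(phiK p) p0 rmorph0.
have [v v0] := IHn (lead_coef (phi p)) (etrans (congr1 negb (lead_coef_eq0 _)) q0).
have g0 : map_poly (meval v) (phi p) != 0.
  apply: contra_neq v0 => /(congr1 (fun g : {poly k} => g`_(size (phi p)).-1)).
  by rewrite coef_map coef0.
have [x x0] := poly_nonroot g0.
exists (fun i => if unlift ord_max i is Some j then v j else x).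
apply: contra_neq x0 => <-.
rewrite -[LHS]/(horner_eval x (map_poly (meval v) (phi p))) /phi !rmorph_mmap.
apply: eq_mmap => [a|i] /=; first by rewrite map_polyC /= /horner_eval hornerC mevalC.
rewrite /horner_eval; case: unlift => [j|]; last by rewrite map_polyX hornerX.
by rewrite map_polyC hornerC /= mevalXU.
Qed.

End Infinite.

(** * Residue fields *)

Lemma integral_embeds (D : comNzRingType) :
  (forall x y : D, x * y = 0 -> (x == 0) || (y == 0)) ->
  exists (K : fieldType) (r : {rmorphism D -> K}), forall x, (r x == 0) = (x == 0).
Proof.
move=> intD.
pose U := [pred x : D | `[< exists y, y * x = 1 >]].
have /choice[inv invP] (x : D) : exists y, if x \in U then y * x = 1 else y = x.
  by case: (boolP (x \in U)) => [/asboolP//|_]; exists x.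
have invl : {in U, left_inverse 1 inv *%R} by move=> x xU; have := invP x; rewrite xU.
have invo : {in [predC U], inv =1 id}.
  by move=> x; rewrite inE => /negPf xU; have := invP x; rewrite xU.
have unitP (x y : D) : y * x = 1 -> U x by move=> yx; apply/asboolP; exists y.
(* Only the fraction field matters; the chosen inverses make D a ring to which
   the fraction field construction applies. *)
pose mU := GRing.ComNzRing_hasMulInverse.Build D invl unitP invo.
pose D1 : comUnitRingType := HB.pack D mU.
pose mI := GRing.ComUnitRing_isIntegral.Build D1 intD.
pose D2 : idomainType := HB.pack D mU mI.
exists {fraction D2}, (@tofrac D2 : {rmorphism D2 -> _}) => x.
exact: (@tofrac_eq0 D2).
Qed.

(** Points of projective space are prime ideals; membership in such a point
    becomes vanishing at a vector of coordinates in a field, where matrices and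
    linear systems are available. *)
Lemma prime_ideal_residue (A : comNzRingType) (P : {pred A}) :
  idealr_closed P -> prime_idealr_closed P ->
  exists (K : fieldType) (r : {rmorphism A -> K}), forall f, (f \in P) = (r f == 0).
Proof.
move=> idP prP.
pose P1 := isIdealr.Build A (mem P) idP.
pose P2 := isPrimeIdealrClosed.Build A (mem P) prP.
pose PI : prime_idealr A := HB.pack (mem P : A -> bool) P1 P2.
have [K [r rP]] := @integral_embeds {ideal_quot PI} (@Quotient.rquot_IdomainAxiom _ PI).
exists K, (r \o \pi_({ideal_quot PI})%qT) => f /=.
have := Quotient.idealrBE PI f 0; rewrite subr0 => fP.
rewrite rP -[RHS]/(\pi_({ideal_quot PI})%qT f == 0).
rewrite -(rmorph0 (\pi_({ideal_quot PI})%qT : {rmorphism A -> _})).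
exact: fP.
Qed.

(** * Connected components *)

Section TwoComponents.
Variable X : topologicalType.
Implicit Types A Z : set X.

Lemma connected_of_dense_point A x :
  A x -> A `<=` closure [set x] -> connected A.
Proof.
move=> Ax Acl B [b Bb] [C oC BC] [D cD BD].
have [Ab Cb] : A b /\ C b by move: Bb; rewrite BC.
have [_ [-> Cx]] : [set x] `&` C !=set0.
  by apply: (Acl b Ab); apply: open_nbhs_nbhs.
have Dx : D x by have : B x by [rewrite BC]; rewrite BD => -[].
rewrite BD; apply/setIidPl => y /Acl.
by move/closure_id : cD => ->; apply: closureS => _ ->.
Qed.

(** A component meets only one part, since a part is relatively closed and,
    as the complement of the other, relatively open. *)
Lemma component_of_closed_partition A Z1 Z2 x :
  closed Z1 -> closed Z2 -> A `<=` Z1 `|` Z2 -> A `&` Z1 `&` Z2 = set0 ->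
  connected (A `&` Z1) -> A x -> Z1 x -> connected_component A x = A `&` Z1.
Proof.
move=> cZ1 cZ2 AZ Z12 con Ax Z1x; apply/seteqP; split; last first.
  by apply: connected_component_max => // y [].
have CA := @connected_component_sub _ A x.
set C := connected_component A x in CA *.
suff <- : C `&` Z1 = C by move=> y [/CA Ay Z1y].
apply: (@component_connected _ A x (C `&` Z1)).
- exists x; split; [exact: connected_component_refl|exact: Z1x].
- exists (~` Z2); first exact: closed_openC.
  apply/seteqP; split=> y [Cy Zy]; split=> //.
    by move=> Z2y; have : set0 y by rewrite -Z12; do !split=> //; exact: CA.
  by case: (AZ y (CA y Cy)).
- by exists Z1.
Qed.

Lemma card_components_closed_partition A Z1 Z2 :
  closed Z1 -> closed Z2 -> A `<=` Z1 `|` Z2 -> A `&` Z1 `&` Z2 = set0 ->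
  connected (A `&` Z1) -> connected (A `&` Z2) ->
  A `&` Z1 !=set0 -> A `&` Z2 !=set0 ->
  (connected_components A #= `I_2)%card.
Proof.
move=> cZ1 cZ2 AZ Z12 con1 con2 [x1 [Ax1 Zx1]] [x2 [Ax2 Zx2]].
have AZ' : A `<=` Z2 `|` Z1 by rewrite setUC.
have Z21 : A `&` Z2 `&` Z1 = set0 by rewrite setIAC.
have comp1 x := component_of_closed_partition cZ1 cZ2 AZ Z12 con1 (x := x).
have comp2 x := component_of_closed_partition cZ2 cZ1 AZ' Z21 con2 (x := x).
have -> : connected_components A = [set A `&` Z1; A `&` Z2].
  apply/seteqP; split=> [_ [y Ay <-]|_ [|] ->].
  - by case: (AZ y Ay) => Zy; [left; exact: comp1|right; exact: comp2].
  - by exists x1 => //; exact: comp1.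
  - by exists x2 => //; exact: comp2.
have neq : A `&` Z1 <> A `&` Z2.
  move=> eqZ; have [_ Z2x1] : (A `&` Z2) x1 by rewrite -eqZ.
  by have : set0 x1 by rewrite -Z12.
apply/eq_cardSP; exists (A `&` Z1); first by left.
suff -> : [set A `&` Z1; A `&` Z2] `\ (A `&` Z1) = [set A `&` Z2] by exact: card_set1.
apply/seteqP; split=> [y [[->|->]] // []//|_ ->].
by split; [right|move/esym].
Qed.

End TwoComponents.

Section ZariskiClosure.
Variables (k : fieldType) (N : nat).

Lemma closed_zeros (E : set {mpoly k[N]}) : closed (zeros E).
Proof. by rewrite -[zeros E]setCK; apply: open_closedC; exists E. Qed.

Lemma zeros_prime_closure (x : proj_space k N) :
  zeros [set f | f \in prime_of x] `<=` closure [set x].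
Proof.
move=> P Px B; rewrite nbhsE => -[U [[E ->] EP] UB].
exists x; split=> //; apply: UB => xE; apply: EP => f /xE; exact: Px.
Qed.

End ZariskiClosure.

(** * Generic points of parametrized cones *)

Section ConePoint.
Variables (k : fieldType) (N : nat) (S : idomainType).
Variables (iota : {rmorphism k -> S}) (C : 'I_N -> S).

(** The extra indeterminate scales C, so that the coefficients of the value of f
    are the values at C of the homogeneous components of f; this is what makes
    the kernel a homogeneous ideal. *)
Definition cone_eval : {mpoly k[N]} -> {poly S} :=
  mmap (polyC \o iota) (fun i => 'X * (C i)%:P).

Lemma cone_eval_term m : mmap1 (fun i => 'X * (C i)%:P) m
  = (mmap1 C m)%:P * 'X^(mdeg m) :> {poly S}.
Proof.
rewrite /mmap1 mdegE -prodrXr rmorph_prod -big_split /=.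
by apply: eq_bigr => i _; rewrite exprMn rmorphXn mulrC.
Qed.

Lemma cone_eval_pihomog e f :
  cone_eval (pihomog mdeg e f) = (cone_eval f)`_e *: 'X^e.
Proof.
rewrite /cone_eval pihomogE rmorph_sum /= {2}/mmap coef_sum scaler_suml.
rewrite [LHS]big_mkcond; apply: eq_bigr => m _ /=.
rewrite cone_eval_term mulrA -polyCM coefCM coefXn.
case: (mdeg m =P e) => [<-|/eqP me]; last by rewrite eq_sym (negPf me) mulr0 scale0r.
rewrite eqxx mulr1 -mul_mpolyC rmorphM /= mmapC mmapX /= cone_eval_term.
by rewrite mulrA -polyCM mul_polyC.
Qed.

Hypothesis C0 : forall i, C i != 0.
Variable i0 : 'I_N.

Fact cone_point_ideal : idealr_closed [pred f | cone_eval f == 0].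
Proof.
split; rewrite ?inE /cone_eval ?rmorph0 ?rmorph1 ?eqxx ?oner_neq0 // => a f g.
by rewrite !inE rmorphD rmorphM /= => /eqP-> /eqP->; rewrite mulr0 addr0.
Qed.

Fact cone_point_prime : prime_idealr_closed [pred f | cone_eval f == 0].
Proof. by move=> f g; rewrite !inE /cone_eval rmorphM /= mulf_eq0. Qed.

Fact cone_point_homog e f : f \in [pred f | cone_eval f == 0] ->
  pihomog [measure of mdeg] e f \in [pred f | cone_eval f == 0].
Proof. by rewrite !inE cone_eval_pihomog => /eqP->; rewrite coef0 scale0r. Qed.

Fact cone_point_torus i : 'X_i \notin [pred f | cone_eval f == 0].
Proof.
by rewrite inE /cone_eval mmapXU mulf_neq0 ?polyX_eq0 // polyC_eq0 C0.
Qed.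

Definition cone_point : proj_space k N :=
  ProjSpace cone_point_ideal cone_point_prime cone_point_homog
    (ex_intro _ i0 (cone_point_torus i0)).

End ConePoint.

(** * Initial forms and one-parameter degenerations *)

Section InitialForms.
Variables (k : fieldType) (R : realType) (N : nat) (w : 'I_N -> nat).

Definition nat_weight (m : 'X_{1..N}) : nat := \sum_(i < N) w i * m i.

Lemma mnm_weight_nat (m : 'X_{1..N}) :
  mnm_weight (fun i => (w i)%:R : R) m = (nat_weight m)%:R.
Proof.
rewrite /mnm_weight /nat_weight natr_sum; apply: eq_bigr => i _.
by rewrite natrM mulr_natr.
Qed.

Lemma initial_form_minE (f : {mpoly k[N]}) m0 :
  m0 \in msupp f -> (forall m, m \in msupp f -> (nat_weight m0 <= nat_weight m)%N) ->
  initial_form (fun i => (w i)%:R : R) f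
  = \sum_(m <- msupp f | nat_weight m == nat_weight m0) f@_m *: 'X_[m].
Proof.
move=> m0f m0min; rewrite /initial_form big_seq_cond [RHS]big_seq_cond.
apply: eq_bigl => m; case mf: (m \in msupp f) => //=; apply/allP/eqP => [mmin|mm0 m' m'f].
  apply/eqP; rewrite eqn_leq m0min // andbT.
  by have := mmin _ m0f; rewrite !mnm_weight_nat ler_nat.
by rewrite !mnm_weight_nat ler_nat mm0 m0min.
Qed.

Lemma min_weight_monomial (f : {mpoly k[N]}) : f != 0 ->
  exists2 m0, m0 \in msupp f &
    forall m, m \in msupp f -> (nat_weight m0 <= nat_weight m)%N.
Proof.
move=> f0.
have exd : exists d, has (fun m => nat_weight m == d) (msupp f).
  exists (nat_weight (mlead f)); apply/hasP; exists (mlead f) => //.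
  exact: mlead_supp.
case: (ex_minnP exd) => d /hasP[m0 m0f /eqP m0d] dmin; exists m0 => // m mf.
by rewrite m0d; apply: dmin; apply/hasP; exists m.
Qed.

(** The lowest power of t in f(t^w q(t)) has the initial form of f, evaluated at
    q(0), as its coefficient. *)
Lemma initial_form_lift (L : comNzRingType) (iota : {rmorphism k -> L})
    (q : 'I_N -> {poly L}) (f : {mpoly k[N]}) :
  mmap (polyC \o iota) (fun i => 'X^(w i) * q i) f = 0 ->
  mmap iota (fun i => (q i)`_0) (initial_form (fun i => (w i)%:R : R) f) = 0.
Proof.
have [->|f0] := eqVneq f 0.
  by move=> _; rewrite /initial_form msupp0 big_nil rmorph0.
have [m0 m0f m0min] := min_weight_monomial f0.
rewrite (initial_form_minE m0f m0min) => /(congr1 (fun g : {poly L} => g`_(nat_weight m0))).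
rewrite coef0 => lift0; apply: etrans lift0.
rewrite rmorph_sum /= [in RHS]/mmap coef_sum big_mkcond /=.
apply: eq_big_seq => m mf.
have -> : mmap1 (fun i => 'X^(w i) * q i) m = 'X^(nat_weight m) * mmap1 q m.
  rewrite /mmap1 /nat_weight -prodrXr -big_split /=.
  by apply: eq_bigr => i _; rewrite exprMn exprM.
rewrite mulrCA coefXnM coefCM; case: (nat_weight m =P nat_weight m0) => [->|/eqP mm0].
  rewrite ltnn subnn -mul_mpolyC rmorphM /= mmapC mmapX; congr (_ * _).
  rewrite -horner_coef0 -[RHS]/(horner_eval 0 _) /mmap1 rmorph_prod.
  by apply: eq_bigr => i _; rewrite rmorphXn /= /horner_eval horner_coef0.
by rewrite ltn_neqAle eq_sym mm0 m0min.
Qed.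

(** The value of f at the truncated point is the value at x of the part of f of
    weight 0.  As weights are nonnegative, this part is either the initial form
    of f or zero. *)
Lemma truncation_zero (K : comNzRingType) (iota : {rmorphism k -> K})
    (x : 'I_N -> K) (f : {mpoly k[N]}) :
  mmap iota x (initial_form (fun i => (w i)%:R : R) f) = 0 ->
  mmap iota (fun i => if w i == 0%N then x i else 0) f = 0.
Proof.
set x' : 'I_N -> K := fun i => _.
have [->|f0] := eqVneq f 0; first by move=> _; rewrite rmorph0.
have [m0 m0f m0min] := min_weight_monomial f0.
have x'0 m : nat_weight m = 0%N -> mmap1 x' m = mmap1 x m.
  move/eqP; rewrite /nat_weight sum_nat_eq0 => /forallP m00.
  apply: eq_bigr => i _; rewrite /x'; have := m00 i; rewrite /= muln_eq0.
  by case/orP=> /eqP ->; rewrite ?eqxx ?expr0.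
have x'1 m : (0 < nat_weight m)%N -> mmap1 x' m = 0.
  rewrite lt0n /nat_weight sum_nat_eq0 negb_forall => /existsP[i].
  rewrite /= muln_eq0 negb_or => /andP[wi mi].
  by rewrite /mmap1 (bigD1 i) //= /x' (negPf wi) expr0n (negPf mi) mul0r.
rewrite (initial_form_minE m0f m0min); case: (posnP (nat_weight m0)) => [m00|m01 _].
  rewrite rmorph_sum m00 => <-; rewrite [LHS]/mmap [RHS]big_mkcond /=.
  apply: eq_bigr => m _; have [/x'0->|] := posnP.
    by rewrite -mul_mpolyC rmorphM /= mmapC mmapX.
  by move/x'1->; rewrite mulr0.
rewrite /mmap big_seq big1 // => m /m0min mm0.
by rewrite x'1 ?mulr0 // (leq_trans m01).
Qed.

Lemma initial_ideal_vanish (K : comNzRingType) (iota : {rmorphism k -> K})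
    (x : 'I_N -> K) (W : 'I_N -> R) (I : set {mpoly k[N]}) :
  (forall f, I f -> mmap iota x (initial_form W f) = 0) ->
  forall g, initial_ideal W I g -> mmap iota x g = 0.
Proof.
move=> Iv g [s [sI ->]]; rewrite rmorph_sum /= big_seq big1 // => u /sI[f If fu].
by rewrite rmorphM /= -fu Iv // mulr0.
Qed.

Lemma initial_ideal_gen (W : 'I_N -> R) (I : set {mpoly k[N]}) f :
  I f -> initial_ideal W I (initial_form W f).
Proof.
move=> If; exists [:: (1, initial_form W f)]; split; last by rewrite big_seq1 mul1r.
by move=> u; rewrite inE => /eqP->; exists f.
Qed.

End InitialForms.

(** * The family of matrices near the Möbius-Kantor configuration *)

Section Configuration.
Variable L : comNzRingType.

Let addL (x y : L) : L := x + y.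
Let mulL (x y : L) : L := x * y.
Let oppL (x : L) : L := - x.
Let subL (x y : L) : L := x - y.
Let L_ring : ring_theory (0 : L) (1 : L) addL mulL subL oppL eq.
Proof.
split=> //; [exact: add0r|exact: addrC|exact: addrA|exact: mul1r|exact: mulrC
  |exact: mulrA|exact: mulrDl|exact: addrN].
Qed.
Add Ring L_ring : L_ring.
(* The operations of L occur under several equal structure projections; they are
   first brought to the form under which the ring structure is declared. *)
Ltac comring :=
  repeat match goal with
  | |- context [@GRing.add ?V] => progress change (@GRing.add V) with addL
  | |- context [@GRing.mul ?V] => progress change (@GRing.mul V) with mulL
  | |- context [@GRing.opp ?V] => progress change (@GRing.opp V) with oppL
  | |- context [@GRing.zero ?V] => progress change (@GRing.zero V) with (0 : L)
  | |- context [@GRing.one ?V] => progress change (@GRing.one V) with (1 : L)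
  end;
  match goal with |- @eq _ ?a ?b => change (@eq (GRing.ComNzRing.sort L) a b) end;
  ring.

Definition det3 (r : nat -> nat -> L) (i j k : nat) : L :=
  r 0%N i * (r 1%N j * r 2%N k - r 2%N j * r 1%N k)
  - r 1%N i * (r 0%N j * r 2%N k - r 2%N j * r 0%N k)
  + r 2%N i * (r 0%N j * r 1%N k - r 1%N j * r 0%N k).

Definition minor3 r (T : seq nat) := det3 r (nth 0%N T 0) (nth 0%N T 1) (nth 0%N T 2).

(** When e lists the maximal minors of a 3 x 9 matrix, this is the adjugate of its
    first three columns times the matrix. *)
Definition cramer (e : seq nat -> L) (i j : nat) : L :=
  if (j < 3)%N then (if i == j then e [:: 0; 1; 2]%N else 0)
  else nth 0 [:: e [:: 1; 2; j]%N; - e [:: 0; 2; j]%N; e [:: 0; 1; j]%N] i.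

Lemma eq_minor3 r r' T :
  (forall i j, (i < 3)%N -> (j < 3)%N -> r i (nth 0%N T j) = r' i (nth 0%N T j)) ->
  minor3 r T = minor3 r' T.
Proof. by move=> rr'; rewrite /minor3 /det3 !rr'. Qed.

Lemma minor3_cramer r T :
  minor3 (cramer (minor3 r)) T = det3 r 0 1 2 * det3 r 0 1 2 * minor3 r T.
Proof.
pose adj i j := nth 0 [:: det3 r 1 2 j; - det3 r 0 2 j; det3 r 0 1 j] i.
rewrite (_ : minor3 _ T = minor3 adj T); last first.
  apply: eq_minor3 => i j' i3 _; move: (nth 0%N T j') => j; rewrite /cramer.
  case: ifP => [|_]; last by case: i i3 => [|[|[|]]].
  by case: i i3 => [|[|[|]]] // _; case: j => [|[|[|]]] // _;
    rewrite /adj /minor3 /det3 /=; apply: esym; comring.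
by rewrite /minor3 /det3 /adj /= /det3; comring.
Qed.

Lemma minor3_scale_rows (d : nat -> L) r T :
  minor3 (fun i j => d i * r i j) T = d 0%N * d 1%N * d 2%N * minor3 r T.
Proof. by rewrite /minor3 /det3; comring. Qed.

Lemma det_mx33 (r : nat -> nat -> L) :
  \det (\matrix_(i < 3, j < 3) r i j) = det3 r 0 1 2.
Proof.
have det2 (A : 'M[L]_2) : \det A = A ord0 ord0 * A ord_max ord_max
    - A ord_max ord0 * A ord0 ord_max.
  rewrite (expand_det_col _ ord0) !big_ord_recl big_ord0 /cofactor !det_mx11 !mxE.
  rewrite !expr0 !expr1 mul1r addr0 mulN1r mulrN.
  by congr (A _ _ * A _ _ - A _ _ * A _ _); apply: val_inj.
rewrite (expand_det_col _ ord0) !big_ord_recl big_ord0 /cofactor !det2 !mxE /=.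
rewrite /det3 /bump /= !addn0 -[(1 + 1)%N]/2%N -[(0 + 1)%N]/1%N !exprS !expr0.
by comring.
Qed.

Definition lines : seq (seq nat) :=
  [:: [:: 0; 1; 3]; [:: 1; 2; 4]; [:: 0; 2; 7]; [:: 2; 3; 5];
      [:: 1; 6; 7]; [:: 3; 4; 6]; [:: 4; 5; 7]; [:: 0; 5; 6]]%N.

Definition triples : seq (seq nat) :=
  [seq T <- [seq a :: s | a <- iota 0 9, s <- [seq [:: b; c] | b <- iota 0 9, c <- iota 0 9]]
     | sorted ltn T].

(** Column j of a family of nine points.  At t = 0 and z^2 + z + 1 = 0 the first
    eight are the Möbius-Kantor configuration, in coordinates adapted to its
    first five points; u is the free ninth point, and a deforms the others. *)
Definition columns (z t : L) (u a : nat -> L) : seq (seq L) :=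
  [:: [:: 1; 0; 0]; [:: 0; 1; 0]; [:: 0; 0; 1];
      [:: 1; 1; t * a 0%N];
      [:: t * a 1%N; 1; 1];
      [:: 1; 1 + t * a 3%N; z + 1 + t * a 4%N];
      [:: 1; z + 1 + t * a 5%N; z + t * a 6%N];
      [:: 1; t * a 2%N; z + t * a 7%N];
      [:: u 0%N; u 1%N; u 2%N]].

(** The parameters are packed in v: 0-8 scale the columns, 9-11 are the ninth
    point and 12-19 the deformation. *)
Definition config (z t : L) (v : nat -> L) (i j : nat) : L :=
  v j * nth 0 (nth [::] (columns z t (fun i => v (9 + i)%N) (fun i => v (12 + i)%N)) j) i.

(** The minors on the lines, in the order of [lines], divided by t and by the
    scalings of the columns. *)
Definition slopes (z t : L) (a : nat -> L) : seq L :=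
  [:: a 0%N; a 1%N; - a 2%N; a 3%N; a 6%N - a 7%N;
      a 6%N - a 5%N - a 1%N * (z + t * a 6%N)
        + a 0%N * (t * a 1%N * (z + 1 + t * a 5%N) - 1);
      a 1%N * ((1 + t * a 3%N) * (z + t * a 7%N) - (z + 1 + t * a 4%N) * (t * a 2%N))
        - (a 7%N - a 4%N) + a 2%N - a 3%N;
      a 6%N + a 3%N * z + t * a 3%N * a 6%N
        - (z + 1) * (a 4%N + a 5%N) - t * a 4%N * a 5%N].

Definition lead (z t : L) (v : nat -> L) (T : seq nat) : L :=
  if T \in lines then
    v (nth 0%N T 0) * v (nth 0%N T 1) * v (nth 0%N T 2)
      * nth 0 (slopes z t (fun i => v (12 + i)%N)) (index T lines)
  else minor3 (config z t v) T.

Lemma lines_triples T : T \in lines -> T \in triples.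
Proof. by move: T; apply/allP; vm_compute. Qed.

Lemma triples_lt9 T i : T \in triples -> (i < 3)%N -> (nth 0%N T i < 9)%N.
Proof.
move=> Tt i3; have : all (fun T => all (fun i => nth 0%N T i < 9)%N (iota 0 3)) triples.
  by vm_compute.
by move/allP/(_ T Tt)/allP => T9; apply: T9; rewrite mem_iota.
Qed.

Lemma eq_cramer e e' i j : {in triples, e =1 e'} -> (j < 9)%N ->
  cramer e i j = cramer e' i j.
Proof.
move=> ee' j9; rewrite /cramer ee' //; case: ifP => // j3.
have ej S : all (fun j => (j < 3)%N || ((S ++ [:: j])%SEQ \in triples)) (iota 0 9) ->
    e (S ++ [:: j]) = e' (S ++ [:: j]).
  by move/allP/(_ j); rewrite mem_iota j3 => /(_ j9)/ee'.
by rewrite (ej [:: 1; 2]%N) ?(ej [:: 0; 2]%N) ?(ej [:: 0; 1]%N) //; vm_compute.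
Qed.

Lemma eq_lead z t v v' T : T \in triples ->
  (forall m, (m < 20)%N -> v m = v' m) -> lead z t v T = lead z t v' T.
Proof.
move=> Tt vv'; have T9 := fun i => triples_lt9 (i := i) Tt.
have vT i : (i < 3)%N -> v (nth 0%N T i) = v' (nth 0%N T i).
  by move=> i3; rewrite vv' // (leq_trans (T9 i i3)).
have cT i j : (j < 3)%N -> config z t v i (nth 0%N T j) = config z t v' i (nth 0%N T j).
  by move=> j3; rewrite /config vT // /columns !(vv' (9 + _)%N) // !(vv' (12 + _)%N).
rewrite /lead; case: ifP => _; last by rewrite /minor3 /det3 !cT.
by rewrite !vT // /slopes !(vv' (12 + _)%N).
Qed.

(** Both sides contain every column equally often, so the scalings cancel and z
    appears as a cross-ratio of the configuration. *)
Lemma lead_cross_ratio z v :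
  lead z 0 v [:: 0; 1; 7]%N * lead z 0 v [:: 1; 2; 3]%N * lead z 0 v [:: 0; 2; 4]%N
  = z * (lead z 0 v [:: 0; 2; 3]%N * lead z 0 v [:: 0; 1; 4]%N * lead z 0 v [:: 1; 2; 7]%N).
Proof. by rewrite /lead /= /minor3 /det3 /config /=; comring. Qed.

(** The equation of z is what makes the last line, 056, degenerate at t = 0. *)
Lemma minor3_config z t v T : z * z + z + 1 = 0 ->
  minor3 (config z t v) T = t ^+ (T \in lines) * lead z t v T.
Proof.
move=> z2; rewrite /lead; case: ifP => [|_]; last by rewrite expr0 mul1r.
rewrite expr1.
do 7?[rewrite inE => /orP[/eqP-> |];
  first by rewrite /minor3 /det3 /config /slopes /=; comring].
rewrite inE => /eqP->; rewrite /minor3 /det3 /config /slopes /=.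
(* At t = 0 the unscaled minor is z - (z + 1)^2. *)
set R := (RHS); transitivity (R - (z * z + z + 1) * (v 0%N * v 5%N * v 6%N)).
  by rewrite /R; comring.
by rewrite z2 mul0r subr0.
Qed.

Lemma mulr_factor3 (X a b c : L) : X * a * (X * b) * (X * c) = X * X * X * (a * b * c).
Proof. by comring. Qed.

Lemma cube_root_pair (z om om' : L) : z * z + z + 1 = 0 ->
  om * om + om + 1 = 0 -> om + om' + 1 = 0 -> (z - om) * (z - om') = 0.
Proof.
move=> z2 om2 sum_om.
transitivity ((z * z + z + 1) - (om * om + om + 1) + (om - z) * (om + om' + 1)).
  by comring.
by rewrite z2 om2 sum_om mulr0 subr0 addr0.
Qed.

Lemma cube_root_conj (om om' : L) :
  om * om + om + 1 = 0 -> om + om' + 1 = 0 -> om' * om' + om' + 1 = 0.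
Proof.
move=> om2 sum_om.
transitivity ((om * om + om + 1) + (om' - om) * (om + om' + 1)); first by comring.
by rewrite om2 sum_om mulr0 addr0.
Qed.

Lemma cube_root_mul (a b c d om : L) : om * om + om + 1 = 0 ->
  (a + b * om) * (c + d * om) = a * c - b * d + (a * d + b * c - b * d) * om.
Proof.
move=> om2; set R := (RHS); transitivity (R + b * d * (om * om + om + 1)).
  by rewrite /R; comring.
by rewrite om2 mulr0 addr0.
Qed.

Lemma cube_root_norm (a b om : L) : om * om + om + 1 = 0 ->
  (a + b * om) * (a - b - b * om) = a * a - a * b + b * b.
Proof.
move=> om2; set R := (RHS); transitivity (R - b * b * (om * om + om + 1)).
  by rewrite /R; comring.
by rewrite om2 mulr0 subr0.
Qed.

End Configuration.

Section ConfigurationMorphism.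
Variables (L L' : comNzRingType) (g : {rmorphism L -> L'}).

Lemma rmorph_minor3 r T : g (minor3 r T) = minor3 (fun i j => g (r i j)) T.
Proof. by rewrite /minor3 /det3 !(rmorphD, rmorphN, rmorphM). Qed.

Lemma rmorph_nth (s : seq L) n : g (nth 0 s n) = nth 0 (map g s) n.
Proof.
by case: (ltnP n (size s)) => sn; [rewrite (nth_map 0)|rewrite !nth_default ?size_map ?rmorph0].
Qed.

Let rmorphE := (rmorphD, rmorphN, rmorphM, rmorph0, rmorph1).

Lemma rmorph_config z t v i j :
  g (config z t v i j) = config (g z) (g t) (g \o v) i j.
Proof.
rewrite /config rmorphM rmorph_nth; congr (_ * nth _ _ _).
have -> (s : seq (seq L)) : map g (nth [::] s j) = nth [::] (map (map g) s) j.
  by case: (ltnP j (size s)) => sj; [rewrite (nth_map [::])|rewrite !nth_default ?size_map].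
by rewrite /= !rmorphE.
Qed.

Lemma rmorph_lead z t v T : g (lead z t v T) = lead (g z) (g t) (g \o v) T.
Proof.
rewrite /lead; case: ifP => _.
  by rewrite !rmorphM rmorph_nth; congr (_ * nth _ _ _); rewrite /= !rmorphE.
rewrite rmorph_minor3 /minor3 /det3 /=.
by rewrite !rmorph_config.
Qed.

Lemma rmorph_cramer e i j : g (cramer e i j) = cramer (g \o e) i j.
Proof.
rewrite /cramer; case: ifP => _; first by case: ifP => _; rewrite ?rmorph0.
by rewrite rmorph_nth /= rmorphN.
Qed.

Lemma rmorph_cube_root (om : L) :
  om * om + om + 1 = 0 -> g om * g om + g om + 1 = 0.
Proof. by move/(congr1 g); rewrite !rmorphD rmorphM rmorph1 rmorph0. Qed.

End ConfigurationMorphism.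

(** * Reconstruction of the parameters over a field *)

Section Reconstruction.
Variable K : fieldType.

Let addK (x y : K) : K := x + y.
Let mulK (x y : K) : K := x * y.
Let oppK (x : K) : K := - x.
Let subK (x y : K) : K := x - y.
Let divK (x y : K) : K := x / y.
Let invK (x : K) : K := x^-1.
Let K_field : field_theory (0 : K) (1 : K) addK mulK subK oppK divK invK eq.
Proof.
split=> //; last by move=> p /eqP p0; rewrite /mulK /invK mulVf.
  split=> //; [exact: add0r|exact: addrC|exact: addrA|exact: mul1r|exact: mulrC
    |exact: mulrA|exact: mulrDl|exact: addrN].
exact/eqP/oner_neq0.
Qed.
Add Field K_field : K_field.
Ltac to_field :=
  repeat match goal with
  | |- context [@GRing.add ?V] => progress change (@GRing.add V) with addK
  | |- context [@GRing.mul ?V] => progress change (@GRing.mul V) with mulK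
  | |- context [@GRing.opp ?V] => progress change (@GRing.opp V) with oppK
  | |- context [@GRing.inv ?V] => progress change (@GRing.inv V) with invK
  | |- context [@GRing.zero ?V] => progress change (@GRing.zero V) with (0 : K)
  | |- context [@GRing.one ?V] => progress change (@GRing.one V) with (1 : K)
  end;
  match goal with |- @eq _ ?a ?b => change (@eq (GRing.Field.sort K) a b) end.
Ltac fielda := to_field; field; repeat split; apply/eqP; assumption.
Ltac fring := to_field; ring.

(** The discriminant of z^2 + z + 1 is -3. *)
Lemma cube_root_disc (z : K) : 1 + 1 + 1 != 0 :> K -> z * z + z + 1 = 0 -> z + z + 1 != 0.
Proof.
move=> three z2; apply: contraNneq three => z1; apply/eqP.
transitivity ((1 + 1 + 1 + 1) * (z * z + z + 1) - (z + z + 1) * (z + z + 1)).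
  by fring.
by rewrite z2 z1; fring.
Qed.

(** This is the smoothness of the realization space of the configuration: the
    eight incidence conditions have independent differentials.  Four parameters
    are read off directly, and the remaining 4 x 4 system reduces to one equation
    for a 6 with leading coefficient -(2z + 1). *)
Lemma slopes_onto z (e : nat -> K) : 1 + 1 + 1 != 0 :> K -> z * z + z + 1 = 0 ->
  exists a, slopes z 0 a = mkseq e 8.
Proof.
move=> three z2; have disc := cube_root_disc three z2.
pose k1 := e 4%N; pose k2 := e 5%N + e 1%N * z + e 0%N.
pose k3 := e 6%N - e 1%N * z + e 2%N + e 3%N; pose k4 := e 7%N - e 3%N * z.
pose a6 := ((z + 1) * (k1 + k2 - k3) - k4) / (z + z + 1).
exists (nth 0 [:: e 0%N; e 1%N; - e 2%N; e 3%N; a6 - k1 + k3; a6 - k2; a6; a6 - k1]).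
rewrite /slopes /mkseq /=; congr [:: _; _; _; _; _; _; _; _].
all: rewrite /a6 /k1 /k2 /k3 /k4; fielda.
Qed.

(** The diagonal matrix d is determined by requiring columns 3 and 4 to become
    proportional to (1, 1, 0) and (0, 1, 1); z is then read off from column 7, the
    lines 235, 167, 346 and 457 determine columns 5 and 6, and the line 056
    is the quadratic equation for z. *)
Lemma realization_normal_form (B : nat -> nat -> K) (X : K) : X != 0 ->
  (forall i j, (i < 3)%N -> (j < 3)%N -> B i j = if i == j then X else 0) ->
  [/\ B 2%N 3%N = 0, B 0%N 4%N = 0 & B 1%N 7%N = 0] ->
  [/\ B 0%N 3%N != 0, B 1%N 3%N != 0, B 1%N 4%N != 0 & B 2%N 4%N != 0] ->
  [/\ B 0%N 5%N != 0, B 0%N 6%N != 0, B 0%N 7%N != 0 & B 2%N 7%N != 0] ->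
  (forall T, T \in lines -> minor3 B T = 0) ->
  exists (d v : nat -> K) (z : K),
    [/\ z * z + z + 1 = 0, forall i, d i != 0, forall j, (j < 9)%N -> v j != 0
      & forall i j, (i < 3)%N -> (j < 9)%N -> B i j = d i * config z 0 v i j].
Proof.
move=> X0 B012 [B23 B04 B17] [B03 B13 B14 B24] [B05 B06 B07 B27] Bl.
have B00 : B 0%N 0%N = X := B012 0%N 0%N isT isT.
have B10 : B 1%N 0%N = 0 := B012 1%N 0%N isT isT.
have B20 : B 2%N 0%N = 0 := B012 2%N 0%N isT isT.
have B01 : B 0%N 1%N = 0 := B012 0%N 1%N isT isT.
have B11 : B 1%N 1%N = X := B012 1%N 1%N isT isT.
have B21 : B 2%N 1%N = 0 := B012 2%N 1%N isT isT.
have B02 : B 0%N 2%N = 0 := B012 0%N 2%N isT isT.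
have B12 : B 1%N 2%N = 0 := B012 1%N 2%N isT isT.
have B22 : B 2%N 2%N = X := B012 2%N 2%N isT isT.
pose Bs := (B00, B10, B20, B01, B11, B21, B02, B12, B22, B23, B04, B17).
have mulX (a b : K) : X * a = b -> b = 0 -> a = 0.
  by move=> <- /eqP; rewrite mulf_eq0 (negPf X0) => /eqP.
have l235 : B 0%N 3%N * B 1%N 5%N - B 1%N 3%N * B 0%N 5%N = 0.
  apply: mulX (Bl [:: 2; 3; 5]%N isT); rewrite /minor3 /det3 /= !Bs; fring.
have l167 : B 2%N 6%N * B 0%N 7%N - B 0%N 6%N * B 2%N 7%N = 0.
  apply: mulX (Bl [:: 1; 6; 7]%N isT); rewrite /minor3 /det3 /= !Bs; fring.
have l056 : B 1%N 5%N * B 2%N 6%N - B 2%N 5%N * B 1%N 6%N = 0.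
  apply: mulX (Bl [:: 0; 5; 6]%N isT); rewrite /minor3 /det3 /= !Bs; fring.
have l346 := Bl [:: 3; 4; 6]%N isT; have l457 := Bl [:: 4; 5; 7]%N isT.
rewrite /minor3 /det3 /= !Bs in l346 l457.
have divE (a b c : K) : b != 0 -> a * b - c = 0 -> a = c / b.
  by move=> b0 /eqP; rewrite subr_eq0 => /eqP <-; rewrite mulfK.
have B15 : B 1%N 5%N = B 1%N 3%N * B 0%N 5%N / B 0%N 3%N.
  by apply: divE => //; rewrite mulrC.
have B26 : B 2%N 6%N = B 0%N 6%N * B 2%N 7%N / B 0%N 7%N by apply: divE.
have B16 : B 1%N 6%N = (B 0%N 3%N * B 1%N 4%N * B 2%N 6%N
    + B 1%N 3%N * B 2%N 4%N * B 0%N 6%N) / (B 0%N 3%N * B 2%N 4%N).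
  by apply: divE; [rewrite mulf_neq0|rewrite -[RHS]oppr0 -[in RHS]l346; fring].
have B25 : B 2%N 5%N = (B 1%N 4%N * B 0%N 5%N * B 2%N 7%N
    + B 2%N 4%N * B 1%N 5%N * B 0%N 7%N) / (B 1%N 4%N * B 0%N 7%N).
  by apply: divE; [rewrite mulf_neq0|rewrite -[in RHS]l457; fring].
pose d0 := B 0%N 3%N; pose d1 := B 1%N 3%N; pose d2 := d1 * B 2%N 4%N / B 1%N 4%N.
pose z := B 2%N 7%N * d0 / (d2 * B 0%N 7%N).
have d20 : d2 != 0 by rewrite /d2 !mulf_neq0 ?invr_eq0.
pose d := nth 1 [:: d0; d1; d2].
pose v := nth 0 [:: X / d0; X / d1; X / d2; 1; B 1%N 4%N / d1; B 0%N 5%N / d0;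
  B 0%N 6%N / d0; B 0%N 7%N / d0; 1; B 0%N 8%N / d0; B 1%N 8%N / d1; B 2%N 8%N / d2].
have z2 : z * z + z + 1 = 0.
  pose m := d1 * d2 * B 0%N 5%N * B 0%N 6%N / (d0 * d0).
  have m0 : m != 0 by rewrite /m !mulf_neq0 ?invr_eq0 // mulf_neq0.
  have zm : (z * z + z + 1) * m = 0.
    rewrite -[RHS]oppr0 -[in RHS]l056 B16 B25 B26 B15 /m /z /d2 /d0 /d1; fielda.
  by move/eqP: zm; rewrite mulf_eq0 (negPf m0) orbF => /eqP.
exists d, v, z; split=> //.
- by do 4?[case=> [|]]; rewrite /d /= ?oner_neq0 // => n; rewrite nth_nil oner_neq0.
- do 9?[case=> [_|]]; rewrite // /v /= ?oner_neq0 //.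
  all: try by rewrite mulf_neq0 // invr_eq0.
case=> [|[|[|//]]] j _; do 9?[case: j => [_|j]]; rewrite //= /config /d /v /= ?Bs.
all: try by (rewrite ?(B15, B16, B25, B26) /z /d2 /d0 /d1; fielda).
all: by rewrite ?mul0r !mulr0.
Qed.

Lemma config0_eq z (v v' : nat -> K) i j : (j < 9)%N ->
  (forall m, (m < 12)%N -> v m = v' m) -> config z 0 v i j = config z 0 v' i j.
Proof.
move=> j9 vv'; rewrite /config vv' ?(leq_trans j9) //.
by rewrite /columns !mul0r /= !(vv' (9 + _)%N).
Qed.

(** Coordinates with the given Plücker relations are values of [lead] at t = 0.
    The coordinates yb, truncated on the lines, are the minors of [cramer yb] up
    to a common factor, and the normal form of this matrix gives all parameters
    except the deformation; [slopes_onto] fits the latter to the values of y on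
    the lines. *)
Lemma lead_parametrizes (y : seq nat -> K) :
  let yb T := if T \in lines then 0 else y T in
  1 + 1 + 1 != 0 :> K ->
  (forall T, T \in triples -> y T != 0) ->
  (forall T, T \in triples ->
    y [:: 0; 1; 2]%N * y [:: 0; 1; 2]%N * yb T = minor3 (cramer yb) T) ->
  exists (z c : K) (v : nat -> K),
    z * z + z + 1 = 0 /\ forall T, T \in triples -> y T = c * lead z 0 v T.
Proof.
set X := y [:: 0; 1; 2]%N => yb three y0 yB; pose B := cramer yb.
have X0 : X != 0 by apply: y0.
have [|||||d [v [z [z2 d0 v0 Bd]]]] := @realization_normal_form B X X0.
- by move=> i j _ j3; rewrite /B /cramer j3.
- by rewrite /B /cramer /= /yb /= oppr0.
- by split; rewrite /B /cramer /yb /= ?oppr_eq0; apply: y0.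
- by split; rewrite /B /cramer /yb /= ?oppr_eq0; apply: y0.
- move=> T Tl; rewrite -yB; first by rewrite /yb Tl mulr0.
  exact: lines_triples.
(* Rescaling the rows multiplies all minors by D; the relations contain the
   square of the coordinate 012. *)
pose D := d 0%N * d 1%N * d 2%N; pose c := D / (X * X).
have D0 : D != 0 by rewrite /D !mulf_neq0.
have c0 : c != 0 by rewrite /c mulf_neq0 // invr_eq0 mulf_neq0.
pose s T := v (nth 0%N T 0) * v (nth 0%N T 1) * v (nth 0%N T 2).
have s0 T : T \in lines -> s T != 0.
  by move=> Tl; rewrite /s !mulf_neq0 ?v0 ?triples_lt9 // lines_triples.
have [a aP] := slopes_onto (fun i => let T := nth [::] lines i in y T / (c * s T)) three z2.
pose v' m := if (m < 12)%N then v m else a (m - 12)%N.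
exists z, c, v'; split=> // T Tt; rewrite /lead.
have T9 := fun i => triples_lt9 (i := i) Tt.
case: ifP => Tl.
  have -> : slopes z 0 (fun i => v' (12 + i)%N) = slopes z 0 a by [].
  rewrite aP nth_mkseq ?index_mem //= nth_index //.
  have -> : v' (nth 0%N T 0) * v' (nth 0%N T 1) * v' (nth 0%N T 2) = s T.
    by rewrite /v' !(leq_trans (T9 _ _)).
  rewrite mulrA invfM; have := s0 _ Tl; move: (s T) (y T) => sT yT sT0.
  by fielda.
have -> : minor3 (config z 0 v') T = minor3 (config z 0 v) T.
  have e i j : (j < 3)%N -> config z 0 v' i (nth 0%N T j) = config z 0 v i (nth 0%N T j).
    by move=> j3; apply: config0_eq; [exact: T9|move=> m m12; rewrite /v' m12].
  by rewrite /minor3 /det3 !e.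
have := yB T Tt; rewrite /yb Tl.
rewrite -/B; have -> : minor3 B T = D * minor3 (config z 0 v) T.
  by rewrite -minor3_scale_rows /minor3 /det3 !Bd ?T9.
by move=> E; apply: (mulfI (mulf_neq0 X0 X0)); rewrite E /c; fielda.
Qed.

End Reconstruction.

(** * Nonvanishing over the Eisenstein integers *)

Section Eisenstein.

(** The ring Z[w] with w^2 + w + 1 = 0, an element being the pair of its
    coordinates on 1 and w: on this representation the 84 values of [lead] at a
    point can be computed. *)
Record eisenstein := Eisenstein { eis_re : int; eis_om : int }.
Let pair_of x := (eis_re x, eis_om x).
Let of_pair p := Eisenstein p.1 p.2.
Fact pair_of_eisK : cancel pair_of of_pair. Proof. by case. Qed.
HB.instance Definition _ := Choice.copy eisenstein (can_type pair_of_eisK).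

Let add x y := Eisenstein (eis_re x + eis_re y) (eis_om x + eis_om y).
Let opp x := Eisenstein (- eis_re x) (- eis_om x).
Let mul x y := Eisenstein (eis_re x * eis_re y - eis_om x * eis_om y)
  (eis_re x * eis_om y + eis_om x * eis_re y - eis_om x * eis_om y).

Let int_ring : ring_theory (0 : int) (1 : int) intZmod.addz intRing.mulz
  (fun x y => intZmod.addz x (intZmod.oppz y)) intZmod.oppz eq.
Proof.
split; [exact: (@add0r int)|exact: (@addrC int)|exact: (@addrA int)|exact: (@mul1r int)
  |exact: (@mulrC int)|exact: (@mulrA int)|exact: (@mulrDl int)|by []|exact: (@addrN int)].
Qed.
Add Ring int_ring : int_ring.
Ltac intring :=
  repeat match goal with
  | |- context [@GRing.add ?V] => progress change (@GRing.add V) with intZmod.addz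
  | |- context [@GRing.mul ?V] => progress change (@GRing.mul V) with intRing.mulz
  | |- context [@GRing.opp ?V] => progress change (@GRing.opp V) with intZmod.oppz
  | |- context [@GRing.zero ?V] => progress change (@GRing.zero V) with (0 : int)
  | |- context [@GRing.one ?V] => progress change (@GRing.one V) with (1 : int)
  end;
  match goal with |- @eq _ ?a ?b => change (@eq int a b) end; ring.

Fact eis_addA : associative add. Proof. by move=> [? ?] [? ?] [? ?]; rewrite /add /= !addrA. Qed.
Fact eis_addC : commutative add.
Proof. by move=> [a b] [c d]; rewrite /add /= addrC [b + d]addrC. Qed.
Fact eis_add0 : left_id (Eisenstein 0 0) add. Proof. by move=> [? ?]; rewrite /add /= !add0r. Qed.
Fact eis_addN : left_inverse (Eisenstein 0 0) opp add.
Proof. by move=> [? ?]; rewrite /add /= !addNr. Qed.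
HB.instance Definition _ := GRing.isZmodule.Build eisenstein eis_addA eis_addC eis_add0 eis_addN.

Fact eis_mulA : associative mul.
Proof. by move=> [a b] [c d] [e f]; rewrite /mul /=; congr Eisenstein; intring. Qed.
Fact eis_mulC : commutative mul.
Proof. by move=> [a b] [c d]; rewrite /mul /=; congr Eisenstein; intring. Qed.
Fact eis_mul1 : left_id (Eisenstein 1 0) mul.
Proof. by move=> [a b]; rewrite /mul /=; congr Eisenstein; intring. Qed.
Fact eis_mulDl : left_distributive mul add.
Proof. by move=> [a b] [c d] [e f]; rewrite /mul /add /=; congr Eisenstein; intring. Qed.
Fact eis_oner_neq0 : Eisenstein 1 0 != 0. Proof. by []. Qed.
HB.instance Definition _ := GRing.Zmodule_isComNzRing.Build eisenstein
  eis_mulA eis_mulC eis_mul1 eis_mulDl eis_oner_neq0.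

Definition eis_norm (x : eisenstein) : int :=
  eis_re x * eis_re x - eis_re x * eis_om x + eis_om x * eis_om x.

(** Scalings 1, ninth point (1, 2, 3), which is on no line through two of the
    eight points, and deformations chosen so that no slope vanishes. *)
Definition test_point (i : nat) : eisenstein :=
  Eisenstein (nth 0 [:: 1; 1; 1; 1; 1; 1; 1; 1; 1; 1; 2; 3; 1; 1; 1; 1; 1; 1; 1; 0] i) 0.

Lemma lead_test_point :
  all (fun T => eis_norm (lead (Eisenstein 0 1) 0 test_point T) != 0) triples.
Proof. by vm_compute. Qed.

Variables (k : fieldType) (om : k).
Hypotheses (char0 : [pchar k] =i pred0) (om2 : om * om + om + 1 = 0).

(** The product of the image of x with the image of its conjugate is the norm of
    x, a nonzero integer. *)
Lemma eisenstein_eval : exists g : {rmorphism eisenstein -> k},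
  g (Eisenstein 0 1) = om /\ forall x, eis_norm x != 0 -> g x != 0.
Proof.
pose g x : k := (eis_re x)%:~R + (eis_om x)%:~R * om.
have gadd : zmod_morphism g.
  move=> [a b] [c d]; rewrite /g /= !rmorphB /= mulrBl opprD !addrA.
  by rewrite [X in X - _]addrAC.
have gmul : monoid_morphism g.
  split=> [|[a b] [c d]]; rewrite /g /= ?mul0r ?addr0 //.
  by rewrite (cube_root_mul _ _ _ _ om2) !(rmorphB, rmorphD, rmorphM).
pose gA := GRing.isZmodMorphism.Build eisenstein k g gadd.
pose gM := GRing.isMonoidMorphism.Build eisenstein k g gmul.
pose G : {rmorphism eisenstein -> k} := HB.pack g gA gM.
exists G; split=> [|x nx]; first by rewrite -[LHS]/(g _) /g /= add0r mul1r.
have int_neq0 (n : int) : n != 0 -> n%:~R != 0 :> k.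
  by case: n => m; rewrite ?NegzE ?mulrNz ?oppr_eq0 -pmulrn ((pcharf0P k).1 char0).
move/int_neq0: nx.
rewrite /eis_norm !(rmorphB, rmorphD, rmorphM) /= -(cube_root_norm _ _ om2).
apply: contraNneq => gx.
by have -> : (eis_re x)%:~R + (eis_om x)%:~R * om = 0 := gx; rewrite mul0r.
Qed.

End Eisenstein.

(** * Minors and the Plücker ideal *)

Section Minors.
Variables (d n : nat).

Definition minor (L : comNzRingType) (A : 'M[L]_(d, n)) (l : dsubset d n) : L :=
  \det (colsub (dsubset_nth l) A).

Lemma rmorph_minor (L L' : comNzRingType) (g : {rmorphism L -> L'}) (A : 'M[L]_(d, n)) l :
  g (minor A l) = minor (map_mx g A) l.
Proof. by rewrite /minor -det_map_mx; congr (\det _); apply/matrixP => i j; rewrite !mxE. Qed.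

Lemma minor_not_row_free (k : fieldType) (A : 'M[k]_(d, n)) l : ~~ row_free A -> minor A l = 0.
Proof.
rewrite /minor => Ar; apply/eqP; apply: contraNT Ar; rewrite -unitfE => detA.
have : colsub (dsubset_nth l) A \in unitmx by rewrite unitmxE.
rewrite -row_free_unit /row_free => /eqP rk.
rewrite eqn_leq rank_leq_row -{1}rk.
have -> : colsub (dsubset_nth l) A = A *m colsub (dsubset_nth l) 1%:M.
  by rewrite mulmx_colsub mulmx1.
exact: mxrankM_maxl.
Qed.

(** Membership in the Plücker ideal only speaks of matrices over k.  Applied to a
    matrix of indeterminates, it says that f becomes a polynomial vanishing at all
    points of an infinite field, hence the zero polynomial, and this identity can
    be evaluated in any ring over k.  Matrices of smaller rank have only zero
    minors, like the vertex c = 0 of the cone. *)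
Lemma plucker_ideal_vanish (k : fieldType) (L : comNzRingType) (iota : {rmorphism k -> L})
    (char0 : [pchar k] =i pred0) (dn : (d <= n)%N) (f : {mpoly k[nplucker d n]})
    (c : L) (A : 'M[L]_(d, n)) :
  @plucker_ideal k d n f -> mmap iota (fun i => c * minor A (enum_val i)) f = 0.
Proof.
move=> If; pose V : finType := option ('I_d * 'I_n).
pose X (o : V) : {mpoly k[#|V|]} := 'X_(enum_rank o).
pose F := mmap (@mpolyC #|V| k)
  (fun i => X None * minor (\matrix_(i, j) X (Some (i, j))) (enum_val i)) f.
have F0 : F = 0.
  apply/eqP; apply: contraT => /(mpoly_nonroot char0)[v].
  pose B : 'M[k]_(d, n) := \matrix_(i, j) v (enum_rank (Some (i, j) : V)).
  have -> : F.@[v] = f.@[fun i => v (enum_rank (None : V)) * plucker_coord B (enum_val i)].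
    rewrite rmorph_mmap; apply: eq_mmap => [a|i] /=; first by rewrite mevalC.
    rewrite mevalM mevalXU rmorph_minor; congr (_ * \det _).
    by apply/matrixP => s t; rewrite !mxE /= mevalXU.
  have [Bf|/minor_not_row_free Bf] := boolP (row_free B); first by rewrite If ?eqxx.
  have rf : row_free (pid_mx d : 'M[k]_(d, n)).
    by rewrite /row_free rank_pid_mx.
  rewrite (_ : _.@[_] = f.@[fun i => 0 * plucker_coord (pid_mx d) (enum_val i)]).
    by rewrite If ?eqxx.
  by apply: meval_eq => i; rewrite mul0r -[plucker_coord _ _]/(minor _ _) Bf mulr0.
pose val_at (i : 'I_#|V|) := if enum_val i is Some ij then A ij.1 ij.2 else c.
have := congr1 (mmap iota val_at) F0; rewrite raddf0 => <-.
rewrite /F rmorph_mmap; apply: eq_mmap => [a|i] /=; first by rewrite mmapC.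
rewrite rmorphM /= mmapXU /val_at enum_rankK rmorph_minor; congr (_ * minor _ _).
by apply/matrixP => s t; rewrite !mxE /= mmapXU /val_at enum_rankK.
Qed.

End Minors.

(** * Three-element subsets as increasing triples *)

Section Triples.

Definition elements d n (l : dsubset d n) : seq nat := [seq val i | i <- enum (val l)].

Lemma dsubset_nthE d n (l : dsubset d n) j : dsubset_nth l j = nth 0%N (elements l) j :> nat.
Proof.
have jl : (j < size (enum (val l)))%N by rewrite -cardE (eqP (valP l)) ltn_ord.
by rewrite /dsubset_nth (enum_val_nth (enum_val (cast_ord (esym (eqP (valP l))) j)))
  /elements (nth_map (enum_val (cast_ord (esym (eqP (valP l))) j))).
Qed.

Lemma elements_set_sorted n (A : {set 'I_n}) : sorted ltn [seq val i | i <- enum A].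
Proof.
rewrite sorted_map /enum_mem; apply: sorted_filter; first by move=> ? ? ?; apply: ltn_trans.
rewrite -sorted_map.
have -> : [seq val i | i <- Finite.enum 'I_n] = iota 0 n by rewrite -enumT val_enum_ord.
exact: iota_ltn_sorted.
Qed.

Lemma elements_triple (l : dsubset 3 9) : elements l \in triples.
Proof.
have sz : size (elements l) = 3%N by rewrite size_map -cardE (eqP (valP l)).
have lt9 : all (fun i => i < 9)%N (elements l).
  by apply/allP => _ /mapP[i _ ->]; rewrite ltn_ord.
rewrite /triples mem_filter [sorted _ _]elements_set_sorted.
case: (elements l) sz lt9 => [|a [|b [|c []]]] // _ /and4P[a9 b9 c9 _].
by apply: allpairs_f; rewrite ?mem_iota //; apply: allpairs_f; rewrite mem_iota.
Qed.

Fact card_first3 : #|[set widen_ord (isT : 3 <= 9)%N i | i : 'I_3]%SET| == 3%N.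
Proof. by rewrite card_imset ?card_ord // => i j /(congr1 val) /= /val_inj. Qed.

Definition of_triple (T : seq nat) : dsubset 3 9 :=
  insubd (@exist {set 'I_9} (fun l => #|l| == 3%N) _ card_first3) [set i : 'I_9 | val i \in T]%SET.

Lemma elementsK (l : dsubset 3 9) : of_triple (elements l) = l.
Proof.
rewrite /of_triple (_ : [set i : 'I_9 | val i \in elements l]%SET = val l) ?valKd //.
by apply/setP => i; rewrite inE mem_map ?mem_enum //; apply: val_inj.
Qed.

Lemma of_tripleK T : T \in triples -> elements (of_triple T) = T.
Proof.
move=> Tt; have /andP[Ts T9] : sorted ltn T && all (fun i => i < 9)%N T.
  by move: T Tt; apply/allP; vm_compute.
have eT : [seq val i | i <- enum [set i : 'I_9 | val i \in T]%SET] = T.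
  apply: (irr_sorted_eq ltn_trans ltnn) => //; first exact: elements_set_sorted.
  move=> i; apply/mapP/idP => [[j + ->]|iT]; first by rewrite mem_enum inE.
  have i9 : (i < 9)%N by move/allP: T9; apply.
  by exists (Ordinal i9); rewrite // mem_enum inE.
rewrite /elements val_insubd ifT //.
rewrite cardE -(size_map val) eT.
by move: T Tt {Ts T9 eT}; apply/allP; vm_compute.
Qed.

Lemma minor_minor3 (L : comNzRingType) (r : nat -> nat -> L) l :
  minor (\matrix_(i < 3, j < 9) r i j) l = minor3 r (elements l).
Proof.
rewrite /minor -[RHS](det_mx33 (fun i j => r i (nth 0%N (elements l) j))).
by congr (\det _); apply/matrixP => i j; rewrite !mxE dsubset_nthE.
Qed.

Variable k : fieldType.

Definition pvar (T : seq nat) : {mpoly k[nplucker 3 9]} := 'X_(enum_rank (of_triple T)).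

Lemma eval_cramer (K : comNzRingType) (g : {rmorphism {mpoly k[nplucker 3 9]} -> K}) e T :
  T \in triples -> {in triples, forall S, g (pvar S) = e S} ->
  g (pvar [:: 0; 1; 2]%N * pvar [:: 0; 1; 2]%N * pvar T - minor3 (cramer pvar) T)
  = e [:: 0; 1; 2]%N * e [:: 0; 1; 2]%N * e T - minor3 (cramer e) T.
Proof.
move=> Tt ge; rewrite rmorphB !rmorphM !ge // rmorph_minor3; congr (_ - _).
apply: eq_minor3 => i j _ j3; rewrite rmorph_cramer; apply: eq_cramer => //.
exact: triples_lt9.
Qed.

(** If A' consists of the first three columns of A, the minors of adj(A') A are
    det(A')^2 times those of A. *)
Lemma cramer_relation T : T \in triples ->
  @plucker_ideal k 3 9
    (pvar [:: 0; 1; 2]%N * pvar [:: 0; 1; 2]%N * pvar T - minor3 (cramer pvar) T).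
Proof.
move=> Tt c A _.
pose a i j := A (inord i) (inord j).
have mA l : plucker_coord A l = minor3 a (elements l).
  rewrite -minor_minor3; congr (\det _).
  by apply/matrixP => i j; rewrite !mxE /a !inord_val.
apply: etrans (eval_cramer (e := fun S => c * minor3 a S) Tt _) _ => [S St|].
  by rewrite /= mevalXU enum_rankK mA of_tripleK.
have -> : minor3 (cramer (fun S => c * minor3 a S)) T
    = c * c * c * minor3 (cramer (minor3 a)) T.
  rewrite -(minor3_scale_rows (fun=> c)); apply: eq_minor3 => i j i3 _.
  rewrite /cramer; case: ifP => _; first by case: ifP; rewrite ?mulr0.
  by case: i i3 => [|[|[|]]] //= _; rewrite mulrN.
rewrite minor3_cramer [c * _ * (c * _)]mulrACA [c * c * _ * (c * _)]mulrACA.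
exact: subrr.
Qed.

End Triples.

(** * The two components *)

Lemma three_neq0 (F : fieldType) : [pchar F] =i pred0 -> 1 + 1 + 1 != 0 :> F.
Proof. by move=> char0; rewrite -addrA -mulr2n -mulrS ((pcharf0P F).1 char0). Qed.

Section Components.
Variables (k : fieldType) (R : realType) (char0 : [pchar k] =i pred0).

Definition line_weight (l : dsubset 3 9) : R := (elements l \in lines)%:R.

Let A := initial_degeneration k line_weight.
Let I := @plucker_ideal k 3 9.
Let N := nplucker 3 9.

Definition gen_param (m : nat) : {mpoly k[20]} := 'X_(inord m).

Definition gen_coord (om : k) (i : 'I_(nplucker 3 9)) : {mpoly k[20]} :=
  lead om%:MP 0 gen_param (elements (enum_val i)).

Lemma eval_gen_lead (K : comNzRingType) (iota : {rmorphism k -> K}) (om : k) (v : nat -> K) T :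
  T \in triples ->
  mmap iota (fun j : 'I_20 => v j) (lead om%:MP 0 gen_param T) = lead (iota om) 0 v T.
Proof.
move=> Tt; rewrite rmorph_lead rmorph0 /= mmapC; apply: eq_lead => // m m20.
by rewrite /= /gen_param mmapXU inordK.
Qed.

(** A polynomial in the parameters is nonzero as soon as one of its values is. *)
Lemma gen_coord_neq0 om i : om * om + om + 1 = 0 -> gen_coord om i != 0.
Proof.
move=> om2; have [g [gom g0]] := eisenstein_eval char0 om2.
have Tt := elements_triple (enum_val i).
have := g0 _ (allP lead_test_point _ Tt); rewrite rmorph_lead rmorph0 gom.
apply: contraNneq => C0.
by rewrite -(eval_gen_lead idfun _ _ Tt) -[lead _ _ _ _]/(gen_coord om i) C0 rmorph0.
Qed.

Lemma cone_eval_pvar om T : T \in triples ->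
  cone_eval (@mpolyC 20 k) (gen_coord om) (pvar k T)
  = 'X * (lead om%:MP 0 gen_param T)%:P.
Proof. by move=> Tt; rewrite /cone_eval mmapXU /gen_coord enum_rankK of_tripleK. Qed.

Lemma cone_eval_pvar3 om T1 T2 T3 : T1 \in triples -> T2 \in triples -> T3 \in triples ->
  cone_eval (@mpolyC 20 k) (gen_coord om) (pvar k T1 * pvar k T2 * pvar k T3)
  = 'X * 'X * 'X * (lead om%:MP 0 gen_param T1 * lead om%:MP 0 gen_param T2
      * lead om%:MP 0 gen_param T3)%:P.
Proof.
move=> /(cone_eval_pvar om) + /(cone_eval_pvar om) + /(cone_eval_pvar om).
move: (lead _ _ _ T1) (lead _ _ _ T2) (lead _ _ _ T3) => a b c.
by rewrite /cone_eval !rmorphM /= => -> -> ->; apply: mulr_factor3.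
Qed.

Section OneRoot.
Variables (om : k) (om2 : om * om + om + 1 = 0).

Definition component_point : proj_space k (nplucker 3 9) :=
  cone_point (@mpolyC 20 k) (fun i => gen_coord_neq0 i om2)
    (enum_rank (of_triple [:: 0; 1; 2]%N)).

(** In the ring where the family lives, the outer indeterminate is the
    degeneration parameter t and the inner one is the scaling of the cone; the
    minors of the family are t^w q. *)
Lemma component_point_degeneration : A component_point.
Proof.
split=> [i|g]; first exact: (cone_point_torus _ (fun i => gen_coord_neq0 i om2)).
move=> gI; apply/eqP; move: g gI.
apply: initial_ideal_vanish => f If.
pose T (i : 'I_N) := elements (enum_val i).
pose q (i : 'I_N) : {poly {poly {mpoly k[20]}}} :=
  'X%:P * lead om%:MP%:P%:P 'X (fun m => (gen_param m)%:P%:P) (T i).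
have q0 i : (q i)`_0 = 'X * (gen_coord om i)%:P.
  rewrite -horner_coef0 hornerM hornerC; congr (_ * _).
  apply: etrans (rmorph_lead (horner_eval 0) _ _ _ _) _.
  apply: etrans _ (esym (rmorph_lead polyC _ _ _ _)).
  congr (lead _ _ _ _); [exact: hornerC| |by apply/funext => m; exact: hornerC].
  exact: etrans (hornerX 0) (esym (rmorph0 _)).
rewrite -(eq_mmap _ (fun=> erefl) q0).
apply: (@initial_form_lift k R N (fun i => (T i \in lines) : nat) _ (polyC \o @mpolyC 20 k) q).
pose g := polyC \o (polyC \o @mpolyC 20 k).
pose M : 'M[{poly {poly {mpoly k[20]}}}]_(3, 9) :=
  \matrix_(i, j) config (g om) 'X (fun m => (gen_param m)%:P%:P) i j.
have z2 := rmorph_cube_root g om2.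
apply: etrans _ (plucker_ideal_vanish g char0 (isT : 3 <= 9)%N 'X%:P M If).
by apply: eq_mmap => // i; rewrite minor_minor3 (minor3_config _ _ _ z2) mulrCA.
Qed.

(** Its vanishing says that the cross-ratio equal to z in the configuration is
    a. *)
Definition cross_ratio_form (a : k) : {mpoly k[nplucker 3 9]} :=
  pvar k [:: 0; 1; 7]%N * pvar k [:: 1; 2; 3]%N * pvar k [:: 0; 2; 4]%N
  - a%:MP * (pvar k [:: 0; 2; 3]%N * pvar k [:: 0; 1; 4]%N * pvar k [:: 1; 2; 7]%N).

Lemma cross_ratio_component : cross_ratio_form om \in prime_of component_point.
Proof.
have l S : S \in [:: [:: 0; 1; 7]; [:: 1; 2; 3]; [:: 0; 2; 4]; [:: 0; 2; 3];
    [:: 0; 1; 4]; [:: 1; 2; 7]]%N -> S \in triples by move: S; apply/allP; vm_compute.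
apply/eqP; apply: etrans (rmorphB (mmap _ _) _ _) _.
apply: etrans (congr2 (fun a b => a - b) _ (rmorphM (mmap _ _) _ _)) _.
  by apply: cone_eval_pvar3; apply: l.
apply: etrans (congr2 (fun a b => _ - a * b) (mmapC _ _ _) (cone_eval_pvar3 _ _ _ _)) _.
1-3: by apply: l.
rewrite lead_cross_ratio; move: (_ * _ * lead _ _ _ _) => a.
by rewrite polyCM mulrCA subrr.
Qed.

Lemma component_closure_connected :
  connected (A `&` zeros [set f | f \in prime_of component_point]).
Proof.
apply: (@connected_of_dense_point _ _ component_point).
  by split=> //; exact: component_point_degeneration.
by move=> P [_ /zeros_prime_closure].
Qed.

End OneRoot.

(** A point of the initial degeneration has coordinates in its residue field that
    are values of [lead], with z a cube root of unity, and a polynomial vanishing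
    at the generic values of [lead] for this z vanishes at all of them. *)
Lemma degeneration_covered (om om' : k) (om2 : om * om + om + 1 = 0)
    (om2' : om' * om' + om' + 1 = 0) : om + om' + 1 = 0 ->
  A `<=` zeros [set f | f \in prime_of (component_point om2)]
    `|` zeros [set f | f \in prime_of (component_point om2')].
Proof.
move=> sum_om P [Pt PI].
have [K [rho rhoP]] := prime_ideal_residue (prime_of_ideal P) (@prime_of_prime _ _ P).
pose iota : {rmorphism k -> K} := rho \o @mpolyC N k.
pose x (i : 'I_N) := rho 'X_i.
have rhoE f : rho f = mmap iota x f := rmorph_mpolyE rho f.
have x0 i : x i != 0 by rewrite /x -rhoP; exact: Pt.
have three : 1 + 1 + 1 != 0 :> K.
  by rewrite -(rmorph1 iota) -!rmorphD fmorph_eq0 three_neq0.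
pose y T := x (enum_rank (of_triple T)).
have xE i : x i = y (elements (enum_val i)) by rewrite /y elementsK enum_valK.
have [|T Tt|z [c [v [z2 yE]]]] := lead_parametrizes (y := y) three.
- by move=> T _; exact: x0.
- have /truncation_zero trunc : mmap iota x (initial_form (fun i => line_weight (enum_val i))
      (pvar k [:: 0; 1; 2]%N * pvar k [:: 0; 1; 2]%N * pvar k T - minor3 (cramer (pvar k)) T)) = 0.
    rewrite -rhoE; apply/eqP; rewrite -rhoP; apply: PI.
    exact/initial_ideal_gen/cramer_relation.
  apply/eqP; rewrite -subr_eq0; apply/eqP; apply: etrans trunc; apply: esym.
  apply: (eval_cramer (e := fun S => if S \in lines then 0 else y S)) => // S St.
  rewrite /= mmapXU enum_rankK of_tripleK // /y.
  by case: (S \in lines).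
have : (z - iota om) * (z - iota om') = 0.
  apply: (cube_root_pair z2 (rmorph_cube_root iota om2)).
  by rewrite -!rmorphD -(rmorph1 iota) -rmorphD sum_om rmorph0.
move/eqP; rewrite mulf_eq0 !subr_eq0.
have key a (a2 : a * a + a + 1 = 0) : z = iota a ->
    zeros [set f | f \in prime_of (component_point a2)] P.
  move=> za g; rewrite /= inE => /eqP g0; rewrite rhoP rhoE.
  have := congr1 (horner_eval c \o map_poly (mmap iota (fun j : 'I_20 => v j))) g0.
  rewrite rmorph0 /cone_eval rmorph_mmap => <-; apply/eqP/eq_mmap => [b|i] /=.
    by rewrite map_polyC /horner_eval hornerC /= mmapC.
  rewrite /horner_eval rmorphM /= map_polyX map_polyC hornerM hornerX hornerC /=.
  by rewrite eval_gen_lead ?elements_triple // xE yE ?elements_triple // za.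
by case/orP => /eqP; [left|right]; exact: key.
Qed.

(** The cross-ratio of the coordinates of a common point would be equal to both
    roots. *)
Lemma components_disjoint (om om' : k) (om2 : om * om + om + 1 = 0)
    (om2' : om' * om' + om' + 1 = 0) : om != om' ->
  A `&` zeros [set f | f \in prime_of (component_point om2)]
    `&` zeros [set f | f \in prime_of (component_point om2')] = set0.
Proof.
move=> neq; apply/seteqP; split=> // P [[[Pt _] Pom] Pom'].
have [K [rho rhoP]] := prime_ideal_residue (prime_of_ideal P) (@prime_of_prime _ _ P).
have cr a (a2 : a * a + a + 1 = 0) :
    zeros [set f | f \in prime_of (component_point a2)] P ->
    rho (cross_ratio_form a) = 0.
  by move=> Pa; apply/eqP; rewrite -rhoP; apply: Pa; exact: cross_ratio_component.
have := congr2 (fun a b => a - b) (cr _ _ Pom') (cr _ _ Pom).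
rewrite -rmorphB subrr /cross_ratio_form opprB addrC addrA addrNK -mulrBl -mpolyCB.
move/eqP; rewrite !rmorphM !mulf_eq0 -!rhoP !(negPf (Pt _)) !orbF rhoP.
by rewrite -[rho _]/((rho \o @mpolyC N k) (om - om')) fmorph_eq0 subr_eq0 (negPf neq).
Qed.

End Components.

Theorem theorem1p4 (k : closedFieldType) (R : realType)
    (char0 : [pchar k] =i pred0) :
  exists w : dsubset 3 9 -> R,
    (connected_components (initial_degeneration k w) #= `I_2)%card.
Proof.
exists (line_weight R).
have [om om2] : exists om : k, om * om + om + 1 = 0.
  have [om omE] := solve_monicpoly (fun=> -1 : k) (isT : 0 < 2)%N; exists om.
  move: omE; rewrite !big_ord_recl big_ord0 expr0 expr1 addr0 mulr1 mulN1r expr2 => ->.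
  by rewrite subrK addNr.
pose om' := - om - 1.
have sum_om : om + om' + 1 = 0 by rewrite /om' addrA subrr add0r addNr.
have om2' := cube_root_conj om2 sum_om.
have neq : om != om'.
  apply: contraTneq (cube_root_disc (three_neq0 char0) om2) => omE.
  by rewrite {2}omE sum_om eqxx.
have cov := @degeneration_covered k R char0 om om' om2 om2' sum_om.
have partition := card_components_closed_partition _ _ cov; apply: partition.
- exact: closed_zeros.
- exact: closed_zeros.
- exact: components_disjoint.
- exact: component_closure_connected.
- exact: component_closure_connected.
- by exists (component_point char0 om2); split=> //; exact: component_point_degeneration.
- by exists (component_point char0 om2'); split=> //; exact: component_point_degeneration.
Qed.
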